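(* Let $(\mathcal X,\rho)$ be a non-empty Polish metric space with Borel $\sigma$-field $\mathfrak B(\mathcal X)$, and let $\mathcal Y\in\mathfrak B(\mathcal X)$ satisfy $$c_{x,0}\,s^{-\gamma}\le \log \mathcal N_{\mathcal X}(s,\mathcal Y,\rho)\le c_{x,1}\,s^{-\gamma}\qquad\text{for all } s\in(0,s_0),$$ for constants $s_0>0$, $0<c_{x,0}<c_{x,1}$, $\gamma>0$. Fix $C>0$, $\beta\in(0,1]$. For $\kappa>0$ let $\mathcal P_{C,\beta,\kappa}$ be the set of pairs $(P_X,P_Y)$ of probability measures on $\mathfrak B(\mathcal X)$ with $P_X(\mathcal Y)=P_Y(\mathcal Y)=1$, $\operatorname{TV}(P_X,P_Y)\ge\kappa$, and such that there is a Borel set $\mathcal Y_0\subseteq\mathcal Y$ with $(P_X+P_Y)(\mathcal Y_0)=2$ and $|p_X(y)-p_X(z)|\le C\rho(y,z)^\beta$ for all $y,z\in\mathcal Y_0$, where $p_X=\mathrm dP_X/\mathrm d(P_X+P_Y)$. Supervised classification model: the training sample $(Z_1,W_1),\dots,(Z_n,W_n)$ is i.i.d., $W_j\in\{0,1\}$, $P[W_1=1]=w$ for a fixed $w\in(0,1)$, and conditionally on $W_j=0$ (resp. $W_j=1$) $Z_j$ has law $P_X$ (resp. $P_Y$); an observation $Z$, independent of the training sample, has law $P_X$ or $P_Y$. A classifier $\varphi_n$ is a Borel measurable map $\mathcal X^n\times\{0,1\}^n\times\mathcal X\to\{0,1\}$ evaluated at $(Z_1,\dots,Z_n,W_1,\dots,W_n,Z)$.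 Its excess risk is $$\mathcal E_n(\varphi_n)=\sup_{(P_X,P_Y)\in\mathcal P_{C,\beta,\kappa}}\big(P_{X,Y,X}[\varphi_n=1]+P_{X,Y,Y}[\varphi_n=0]-1+\operatorname{TV}(P_X,P_Y)\big),$$ where $P_{X,Y,X}$, $P_{X,Y,Y}$ denote the probability when $Z$ has law $P_X$, respectively $P_Y$. Then there exists $\kappa_0>0$ (not depending on $n$) such that for every $\kappa\in(0,\kappa_0)$ and every sequence of classifiers $\{\varphi_n\}_n$, $$\liminf_{n\to\infty}(\log n)^{\beta/\gamma}\,\mathcal E_n(\varphi_n)>0.$$
   Context: $\mathcal N_{\mathcal X}(\delta,\mathcal Y,\rho)$ denotes the minimal number of open $\rho$-balls in $\mathcal X$ of radius $\delta$ whose union contains $\mathcal Y$. $\operatorname{TV}(P,Q)=\sup_{A\in\mathfrak B(\mathcal X)}|P(A)-Q(A)|$. *)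

(* Defs.v *)
From HB Require Import structures.
From mathcomp Require Import all_boot all_order all_algebra.
From mathcomp Require Import all_classical all_reals all_analysis.
Set Implicit Arguments. Unset Strict Implicit. Unset Printing Implicit Defensive.
Import Order.TTheory GRing.Theory Num.Theory.
Import numFieldNormedType.Exports.
Local Open Scope classical_set_scope.
Local Open Scope ring_scope.

Section metric_defs.
Context {R : realType} {X : Type}.
Implicit Types (rho : X -> X -> R).

Definition is_metric rho : Prop :=
  [/\ (forall x y, 0 <= rho x y), (forall x y, rho x y = 0 <-> x = y),
      (forall x y, rho x y = rho y x) &
      (forall x y z, rho x z <= rho x y + rho y z)].

Definition rho_ball rho (x : X) (r : R) : set X := [set y | rho x y < r].

Definition rho_open rho (U : set X) : Prop :=
  forall x, U x -> exists2 r, 0 < r & rho_ball rho x r `<=` U.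

Definition rho_cauchy rho (u : nat -> X) : Prop :=
  forall e, 0 < e -> exists N, forall m n, (N <= m)%N -> (N <= n)%N ->
    rho (u m) (u n) < e.

Definition rho_cvg rho (u : nat -> X) (x : X) : Prop :=
  forall e, 0 < e -> exists N, forall n, (N <= n)%N -> rho (u n) x < e.

Definition rho_complete rho : Prop :=
  forall u, rho_cauchy rho u -> exists x, rho_cvg rho u x.

Definition rho_separable rho : Prop :=
  exists D : set X, countable D /\
    forall x e, 0 < e -> exists2 y, D y & rho x y < e.

Definition polish_metric rho : Prop :=
  [/\ is_metric rho, rho_complete rho & rho_separable rho].

Definition covers_with rho (delta : R) (Y : set X) (k : nat) : Prop :=
  exists c : 'I_k -> X, Y `<=` \bigcup_(i in [set: 'I_k]) rho_ball rho (c i) delta.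

(** covering number N_X(delta, Y, rho) (+oo if no finite cover exists) *)
Definition covering_number rho (delta : R) (Y : set X) : \bar R :=
  ereal_inf [set (k%:R)%:E | k in covers_with rho delta Y].

End metric_defs.

Section prob_defs.
Context {R : realType} {d : measure_display} {X : measurableType d}.

Definition TV (P Q : probability X R) : R :=
  sup [set `|fine (P A) - fine (Q A)| | A in measurable].

Definition is_density (mu nu : {measure set X -> \bar R}) (p : X -> R) : Prop :=
  [/\ measurable_fun setT p, (forall x, 0 <= p x) &
      forall A, measurable A -> nu A = (\int[mu]_(x in A) (p x)%:E)%E].

Definition in_class (rho : X -> X -> R) (Y : set X) (C beta kappa : R)
    (PX PY : probability X R) : Prop :=
  [/\ PX Y = 1%E, PY Y = 1%E, kappa <= TV PX PY &
      exists Y0 : set X, [/\ measurable Y0, Y0 `<=` Y,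
        measure_add PX PY Y0 = 2%:E &
        exists pX : X -> R, is_density (measure_add PX PY) PX pX /\
          forall y z, Y0 y -> Y0 z -> `|pX y - pX z| <= C * rho y z `^ beta]].

(** Expectation over the i.i.d. training sample (Z_1,W_1),...,(Z_k,W_k):
    W_j ~ Bernoulli(w), Z_j | W_j = 0 ~ PX, Z_j | W_j = 1 ~ PY
    (iterated integral = integral against the product law, by Tonelli). *)
Fixpoint sample_int (PX PY : probability X R) (w : R) (k : nat) :
    (k.-tuple X -> k.-tuple bool -> \bar R) -> \bar R :=
  match k return (k.-tuple X -> k.-tuple bool -> \bar R) -> \bar R with
  | 0 => fun F => F [tuple] [tuple]
  | k'.+1 => fun F =>
      ((1 - w)%:E * \int[PX]_x
          sample_int PX PY w (fun xs bs => F (cons_tuple x xs) (cons_tuple false bs))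
       + w%:E * \int[PY]_x
          sample_int PX PY w (fun xs bs => F (cons_tuple x xs) (cons_tuple true bs)))%E
  end.

Definition classifier (n : nat) := (n.-tuple X * n.-tuple bool * X)%type -> bool.

Definition prob_pred (PX PY : probability X R) (w : R) (n : nat)
    (phi : classifier n) (Q : probability X R) (b : bool) : \bar R :=
  sample_int PX PY w (fun xs bs => Q [set z | phi (xs, bs, z) = b]).

Definition excess_risk (rho : X -> X -> R) (Y : set X) (C beta kappa w : R)
    (n : nat) (phi : classifier n) : \bar R :=
  ereal_sup [set r | exists PX PY : probability X R, in_class rho Y C beta kappa PX PY /\
    r = (prob_pred PX PY w phi PX true + prob_pred PX PY w phi PY false
         - 1 + (TV PX PY)%:E)%E].

End prob_defs.

(* Main.v *)
Require Import Defs.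
From HB Require Import structures.
From mathcomp Require Import all_boot all_order all_algebra.
From mathcomp Require Import all_classical all_reals all_analysis.
From mathcomp Require Import measurable_realfun ring lra.
Import Order.TTheory GRing.Theory Num.Theory.
Import numFieldNormedType.Exports.
Local Open Scope classical_set_scope.
Local Open Scope ring_scope.

(** Assouad's argument on a finite set of atoms.  Cover Y by K balls of a fixed
    radius r.  At scale s = (2 log n / c0)^(-1/gamma) the covering number of Y
    is at least n^2 > 2 K n, so one of these balls contains 2n points of Y that
    are s-separated; two further points of Y lie at distance at least r from
    that ball.  The far points carry fixed amplitudes +eta, -eta of p_X - 1/2,
    which secures TV >= eta = kappa0.  The separated points come in n pairs with
    amplitudes +delta, -delta or -delta, +delta, where delta = C s^beta / 2 is
    the largest amplitude the Hölder condition allows.  A sample of size n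
    misses any given pair with probability at least 1/2, and then carries no
    information on its sign, so averaging over the signs gives an excess risk of
    at least delta/2, which is of order (log n)^(-beta/gamma).  Only lower bounds
    of integrals against atomic measures are needed, and these hold for
    arbitrary nonnegative integrands. *)

(** * Finitely supported measures and integrals against them *)

Lemma finite_atomic_measure {R : realType} {d : measure_display}
    {X : measurableType d} {I : finType} (pt : I -> X) (c : I -> R) :
  (forall i, 0 <= c i) ->
  exists mu : {measure set X -> \bar R},
    forall A, mu A = (\sum_i c i * \1_A (pt i))%:E.
Proof.
move=> c0; elim: (index_enum I) => [|i s [mu muE]].
  by exists mzero => A; rewrite big_nil.
exists (measure_add (mscale (NngNum (c0 i)) (dirac (pt i))) mu) => A.
transitivity (mscale (NngNum (c0 i)) (dirac (pt i)) A + mu A)%E.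
  exact: measure_addE.
by rewrite muE big_cons EFinD EFinM.
Qed.

(** Normalising a measure of mass 1 leaves it unchanged and supplies the probability structure. The
    Dirac default needs an index, which exists because an empty sum is not 1. *)
Lemma finite_atomic_probability {R : realType} {d : measure_display}
    {X : measurableType d} {I : finType} (pt : I -> X) (c : I -> R) :
  (forall i, 0 <= c i) -> \sum_i c i = 1 ->
  exists P : probability X R, forall A, P A = (\sum_i c i * \1_A (pt i))%:E.
Proof.
move=> c0 c1; have [mu muE] := finite_atomic_measure pt _ c0.
have muT : mu setT = 1%E.
  by rewrite muE -c1; congr EFin; apply: eq_bigr => i _; rewrite indicT mulr1.
have [i _] : exists i : I, True.
  have [I0|/card_gt0P[i _]] := posnP #|I|; last by exists i.
  move: c1; rewrite big1 => [/eqP|i _]; first by rewrite eq_sym oner_eq0.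
  by have := card0_eq I0 i; rewrite inE.
exists (mnormalize mu (dirac (pt i))) => A.
rewrite -muE; transitivity (mnormalize mu (dirac (pt i)) A) => //.
have muT' : (mu : set X -> \bar R) setT = 1%E := muT.
by rewrite /mnormalize muT' onee_eq0 /= invr1 mule1.
Qed.

(** The integral of a nonnegative function is the supremum over the simple functions below it, and a
    larger integrand has more of these. *)
Lemma ge0_le_integral_nonmeasurable {R : realType} {d : measure_display}
    {X : measurableType d} (mu : {measure set X -> \bar R}) (f g : X -> \bar R) :
  (forall x, 0 <= f x)%E -> (forall x, f x <= g x)%E ->
  (\int[mu]_x f x <= \int[mu]_x g x)%E.
Proof.
move=> f0 fg; have g0 x : (0 <= g x)%E by rewrite (le_trans (f0 x)).
rewrite !ge0_integralTE//; apply: ereal_sup_le => _ [h hf <-].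
by exists h => // x; rewrite (le_trans (hf x)).
Qed.

Section atomic_integral.
Context {R : realType} {d : measure_display} {X : measurableType d}.
Context {I : finType} {pt : I -> X}.
Hypothesis measurable_pt : forall i, measurable [set pt i].
Hypothesis pt_inj : injective pt.

Lemma sum_indic_pt (g : I -> R) (j : I) :
  \sum_i g i * \1_[set pt i] (pt j) = g j.
Proof.
rewrite (bigD1 j) //= indicE mem_set // mulr1 big1 ?addr0 // => i ij.
by rewrite indicE memNset ?mulr0 //= => /pt_inj /esym/eqP; rewrite (negbTE ij).
Qed.

Lemma integral_atomic (mu : {measure set X -> \bar R}) (c g : I -> R)
    (D : set X) :
  measurable D -> (forall i, 0 <= g i) ->
  (forall A, mu A = (\sum_i c i * \1_A (pt i))%:E) ->
  (\int[mu]_(x in D) (\sum_i g i * \1_[set pt i] x)%:E =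
   (\sum_i c i * \1_D (pt i) * g i)%:E)%E.
Proof.
move=> mD g0 muE; under eq_integral do rewrite -sumEFin.
rewrite ge0_integral_sum //; last 2 first.
- by move=> i; apply/measurable_EFinP; apply: measurable_funM.
- by move=> i x _; rewrite lee_fin mulr_ge0.
rewrite -sumEFin; apply: eq_bigr => i _.
under eq_integral do rewrite EFinM.
rewrite ge0_integralZl //; last 2 first.
- by apply/measurable_EFinP; apply: measurable_indic.
- by rewrite lee_fin.
rewrite integral_indic // muE -EFinM mulrC; congr (_ * _)%:E.
rewrite -[RHS](sum_indic_pt (fun k => c k * \1_D (pt k)) i).
apply: eq_bigr => k _; rewrite !indicE in_setI -mulrA; congr (_ * _).
rewrite -natrM mulnb andbC; congr (_ && _)%:R.
by apply/idP/idP; rewrite !inE => ->.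
Qed.

(** [f] dominates the simple function equal to [g (pt i)] at [pt i] and to 0 off the atoms, whose
    integral is the sum. *)
Lemma ge_integral_atomic (mu : {measure set X -> \bar R}) (c : I -> R)
    (f : X -> \bar R) (g : X -> R) :
  (forall A, mu A = (\sum_i c i * \1_A (pt i))%:E) ->
  (forall x, 0 <= g x) -> (forall x, (g x)%:E <= f x)%E ->
  ((\sum_i c i * g (pt i))%:E <= \int[mu]_x f x)%E.
Proof.
move=> muE g0 gf.
have -> : \sum_i c i * g (pt i) = \sum_i c i * \1_setT (pt i) * g (pt i).
  by apply: eq_bigr => i _; rewrite indicT mulr1.
rewrite -(@integral_atomic mu c (g \o pt) setT) //; last by move=> i /=.
apply: ge0_le_integral_nonmeasurable => x.
  by rewrite lee_fin sumr_ge0 // => i _; rewrite mulr_ge0 //=.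
apply: le_trans (gf x); rewrite lee_fin.
have [[j <-]|xn] := pselect (exists j, pt j = x); first by rewrite sum_indic_pt.
rewrite big1 // => i _; rewrite indicE memNset ?mulr0 //= => xi.
by apply: xn; exists i.
Qed.

End atomic_integral.

(** * Expectations over samples of atoms *)

(* Expectation over k independent draws (W, i) with weights [q], the training
   pair being (pt i, W).  The weights are not normalised: restricting [q] to a
   set of atoms restricts the expectation to samples inside that set. *)
Fixpoint atomic_sample_sum {R : realType} {X : Type} {I : finType} (pt : I -> X)
    (q : bool * I -> R) {k : nat} :
    (k.-tuple X -> k.-tuple bool -> R) -> R :=
  match k return (k.-tuple X -> k.-tuple bool -> R) -> R with
  | 0 => fun G => G [tuple] [tuple]
  | k'.+1 => fun G => \sum_z q z * atomic_sample_sum pt q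
      (fun xs bs => G (cons_tuple (pt z.2) xs) (cons_tuple z.1 bs))
  end.

Section atomic_sample_sum.
Context {R : realType} {X : Type} {I : finType} (pt : I -> X).
Implicit Types q : bool * I -> R.

Lemma atomic_sample_sum_cst q k (c : R) :
  atomic_sample_sum pt q (fun (_ : k.-tuple X) _ => c) = (\sum_z q z) ^+ k * c.
Proof.
elim: k => [|k IHk] /=; first by rewrite expr0 mul1r.
by under eq_bigr do rewrite IHk; rewrite -mulr_suml exprS mulrA.
Qed.

Lemma atomic_sample_sumD q k (F G : k.-tuple X -> k.-tuple bool -> R) :
  atomic_sample_sum pt q (fun xs bs => F xs bs + G xs bs) =
  atomic_sample_sum pt q F + atomic_sample_sum pt q G.
Proof.
elim: k F G => [//|k IHk] F G /=.
by rewrite -big_split /=; apply: eq_bigr => z _; rewrite IHk mulrDr.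
Qed.

Lemma atomic_sample_sumZ q k (c : R) (F : k.-tuple X -> k.-tuple bool -> R) :
  atomic_sample_sum pt q (fun xs bs => c * F xs bs) =
  c * atomic_sample_sum pt q F.
Proof.
elim: k F => [//|k IHk] F /=.
by rewrite mulr_sumr; apply: eq_bigr => z _; rewrite IHk mulrCA.
Qed.

Lemma atomic_sample_sum_sum q k (J : finType)
    (F : J -> k.-tuple X -> k.-tuple bool -> R) :
  atomic_sample_sum pt q (fun xs bs => \sum_j F j xs bs) =
  \sum_j atomic_sample_sum pt q (F j).
Proof.
elim: k F => [//|k IHk] F /=.
rewrite exchange_big; apply: eq_bigr => z _ /=.
by rewrite IHk mulr_sumr.
Qed.

Lemma atomic_sample_sum_ge0 q k (F : k.-tuple X -> k.-tuple bool -> R) :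
  (forall z, 0 <= q z) -> (forall xs bs, 0 <= F xs bs) ->
  0 <= atomic_sample_sum pt q F.
Proof.
move=> q0; elim: k F => [|k IHk] F F0 //=.
by apply: sumr_ge0 => z _; rewrite mulr_ge0 // IHk.
Qed.

Lemma le_atomic_sample_sum q1 q2 k (F : k.-tuple X -> k.-tuple bool -> R) :
  (forall z, 0 <= q1 z <= q2 z) -> (forall xs bs, 0 <= F xs bs) ->
  atomic_sample_sum pt q1 F <= atomic_sample_sum pt q2 F.
Proof.
move=> q12; elim: k F => [|k IHk] F F0 //=.
apply: ler_sum => z _; have /andP[q10 q1q2] := q12 z.
by rewrite ler_pM ?IHk // atomic_sample_sum_ge0 // => u; case/andP: (q12 u).
Qed.

End atomic_sample_sum.

(** Induction on [k]: splitting the sum by the label [W] matches the two integrals of [sample_int],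
    each bounded below by its sum over atoms. *)
Lemma le_atomic_sample_sum_int {R : realType} {d : measure_display}
    {X : measurableType d} {I : finType} (pt : I -> X) (a b : I -> R)
    (PX PY : probability X R) (w : R) (k : nat)
    (F : k.-tuple X -> k.-tuple bool -> \bar R)
    (G : k.-tuple X -> k.-tuple bool -> R) :
  (forall i, measurable [set pt i]) -> injective pt ->
  (forall A, PX A = (\sum_i a i * \1_A (pt i))%:E) ->
  (forall A, PY A = (\sum_i b i * \1_A (pt i))%:E) ->
  (forall i, 0 <= a i) -> (forall i, 0 <= b i) -> 0 <= w <= 1 ->
  (forall xs bs, 0 <= G xs bs) -> (forall xs bs, (G xs bs)%:E <= F xs bs)%E ->
  ((atomic_sample_sum pt
      (fun z => if z.1 then w * b z.2 else (1 - w) * a z.2) G)%:E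
   <= sample_int PX PY w F)%E.
Proof.
move=> mpt ptI PXE PYE a0 b0 /andP[w0 w1]; set q := (fun z => _).
have w'0 : 0 <= 1 - w by rewrite subr_ge0.
have q0 z : 0 <= q z by rewrite /q; case: ifP => _; rewrite mulr_ge0.
elim: k F G => [|k IHk] F G G0 GF; first exact: GF.
rewrite /= -(pair_bigA _ (fun v i => q (v, i) * atomic_sample_sum pt q
  (fun xs bs => G (cons_tuple (pt i) xs) (cons_tuple v bs)))) /= big_bool /=.
rewrite addrC EFinD; apply: leeD.
  under eq_bigr do rewrite /q /= -mulrA.
  rewrite -mulr_sumr EFinM lee_wpmul2l ?lee_fin //.
  apply: (ge_integral_atomic mpt ptI _ _ _
    (fun x => atomic_sample_sum pt q
      (fun xs bs => G (cons_tuple x xs) (cons_tuple false bs))) PXE).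
    by move=> x; exact: atomic_sample_sum_ge0.
  by move=> x; exact: IHk.
under eq_bigr do rewrite /q /= -mulrA.
rewrite -mulr_sumr EFinM lee_wpmul2l ?lee_fin //.
apply: (ge_integral_atomic mpt ptI _ _ _
  (fun x => atomic_sample_sum pt q
    (fun xs bs => G (cons_tuple x xs) (cons_tuple true bs))) PYE).
  by move=> x; exact: atomic_sample_sum_ge0.
by move=> x; exact: IHk.
Qed.

(** * Excess risk at a pair of atomic laws *)

Section excess_risk_atomic.
Context {R : realType} {d : measure_display} {X : measurableType d}.
Context {I : finType} {pt : I -> X}.
Hypothesis measurable_pt : forall i, measurable [set pt i].
Hypothesis pt_inj : injective pt.

Lemma measurable_bigcup_pt (D : set I) : measurable (\bigcup_(i in D) [set pt i]).
Proof. by apply: fin_bigcup_measurable => //; exact: finite_finset. Qed.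

Lemma indic_bigcup_pt (D : set I) (j : I) :
  \1_(\bigcup_(i in D) [set pt i]) (pt j) = \1_D j :> R.
Proof.
rewrite !indicE; congr (_ : bool)%:R; apply/idP/idP; rewrite !inE /=.
  by move=> [i Di /pt_inj ->].
by move=> Dj; exists j.
Qed.

Lemma le_TV (P Q : probability X R) (A : set X) :
  measurable A -> fine (P A) - fine (Q A) <= TV P Q.
Proof.
move=> mA; apply: le_trans (ler_norm _) _; apply: ub_le_sup; last by exists A.
exists 1 => _ [B mB <-].
have PB (S : probability X R) : 0 <= fine (S B) <= 1.
  rewrite fine_ge0 //= -lee_fin fineK ?fin_num_measure //.
  exact: probability_le1.
by have := PB P; have := PB Q; rewrite ler_norml; lra.
Qed.

Variables (rho : X -> X -> R) (Y : set X) (C beta kappa w : R).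
(* The regression function is p = 1/2 -/+ amp at pt i; the Bayes classifier
   answers [t i], and TV = sum_i mu i * amp i. *)
Variables (mu amp : I -> R) (t : I -> bool).
Let s i := (-1) ^+ t i * amp i.
Let a i := mu i * (2^-1 + s i).
Let b i := mu i * (2^-1 - s i).
Hypotheses (w01 : 0 <= w <= 1) (YI : forall i, Y (pt i)).
Hypotheses (mu0 : forall i, 0 <= mu i) (amp01 : forall i, 0 <= amp i <= 2^-1).
Hypotheses (mu2 : \sum_i mu i = 2) (mus0 : \sum_i mu i * s i = 0).
Hypothesis kappa_le : kappa <= \sum_i mu i * amp i.
Hypothesis s_holder : forall i j, `|s i - s j| <= C * rho (pt i) (pt j) `^ beta.

Let s_le i : - 2^-1 <= s i <= 2^-1.
Proof.
by have := amp01 i; rewrite /s; case: (t i); rewrite /= ?expr0 ?expr1; lra.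
Qed.

Let a0 i : 0 <= a i.
Proof. by rewrite /a mulr_ge0 //; have := s_le i; lra. Qed.

Let b0 i : 0 <= b i.
Proof. by rewrite /b mulr_ge0 //; have := s_le i; lra. Qed.

Let a1 : \sum_i a i = 1.
Proof.
under eq_bigr do rewrite /a mulrDr.
by rewrite big_split /= mus0 -mulr_suml mu2 addr0 mulfV ?pnatr_eq0.
Qed.

Let b1 : \sum_i b i = 1.
Proof.
under eq_bigr do rewrite /b mulrBr.
by rewrite big_split /= sumrN mus0 -mulr_suml mu2 subr0 mulfV ?pnatr_eq0.
Qed.

Let in_class_atomic (PX PY : probability X R) :
  (forall A, PX A = (\sum_i a i * \1_A (pt i))%:E) ->
  (forall A, PY A = (\sum_i b i * \1_A (pt i))%:E) ->
  \sum_i mu i * amp i <= TV PX PY ->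
  in_class rho Y C beta kappa PX PY.
Proof.
move=> PXE PYE leTV.
have full (c : I -> R) (S : set X) : (forall i, S (pt i)) ->
    \sum_i c i * \1_S (pt i) = \sum_i c i.
  by move=> SI; apply: eq_bigr => i _; rewrite indicE mem_set // mulr1.
have sumE A : measure_add PX PY A = (\sum_i mu i * \1_A (pt i))%:E.
  transitivity (PX A + PY A)%E; first exact: measure_addE.
  rewrite PXE PYE -EFinD -big_split /=; congr EFin; apply: eq_bigr => i _.
  by rewrite /a /b; field.
split; first by rewrite PXE full // a1.
- by rewrite PYE full // b1.
- exact: le_trans kappa_le leTV.
exists (\bigcup_(i in setT) [set pt i]); split.
- exact: measurable_bigcup_pt.
- by move=> _ [i _ ->].
- by rewrite sumE full ?mu2 // => i; exists i.
have p0 i : 0 <= 2^-1 + s i by have := s_le i; lra.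
exists (fun x => \sum_i (2^-1 + s i) * \1_[set pt i] x); split; first split.
- by apply: measurable_sum => i; apply: measurable_funM.
- by move=> x; apply: sumr_ge0 => i _; rewrite mulr_ge0.
- move=> A mA; rewrite (integral_atomic measurable_pt pt_inj _ mu) //.
  transitivity (\sum_i a i * \1_A (pt i))%:E; first exact: PXE.
  by congr EFin; apply: eq_bigr => i _; rewrite /a mulrAC.
move=> _ _ [i _ ->] [j _ ->].
rewrite !(sum_indic_pt pt_inj (fun i => 2^-1 + s i)).
by rewrite opprD addrACA subrr add0r.
Qed.

(** The two errors at atom [i] add up to min([a i], [b i]), plus |[a i] - [b i]| =
    [2 * mu i * amp i] when [phi] disagrees with [t i]. The minima sum to [1 - T], and the term
    [-1 + TV] is at least [T - 1]. *)
Lemma excess_risk_ge (n : nat) (phi : @classifier d X n) :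
  ((2 * \sum_i mu i * amp i * atomic_sample_sum pt
      (fun z => if z.1 then w * b z.2 else (1 - w) * a z.2)
      (fun xs bs => (phi (xs, bs, pt i) != t i)%:R))%:E
   <= excess_risk rho Y C beta kappa w phi)%E.
Proof.
set q : bool * I -> R := (fun z => if z.1 then _ else _); set T := \sum_i mu i * amp i.
have [PX PXE] := finite_atomic_probability pt _ a0 a1.
have [PY PYE] := finite_atomic_probability pt _ b0 b1.
have leTV : T <= TV PX PY.
  (* [A] is a set of atoms with [b i <= a i] whose complement has [a i <= b i]. *)
  pose A := \bigcup_(i in [set i | ~~ t i]) [set pt i].
  have := @le_TV PX PY A (measurable_bigcup_pt _).
  rewrite PXE PYE /= -sumrB; apply: le_trans.
  (* Adding the vanishing sum of [mu i * s i] makes each term [2 * mu i * amp i] on [A] and 0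
     elsewhere. *)
  have -> : T = \sum_i (mu i * s i + mu i * amp i).
    by rewrite big_split /= mus0 add0r.
  apply: ler_sum => i _.
  have memN : (i \in [set i | ~~ t i]) = ~~ t i.
    by apply/idP/idP; rewrite inE.
  rewrite indic_bigcup_pt indicE memN -mulrBl /a /b /s.
  by case: (t i); rewrite /= ?expr0 ?expr1; lra.
apply: le_ereal_sup_tmp.
exists (prob_pred PX PY w phi PX true + prob_pred PX PY w phi PY false
        - 1 + (TV PX PY)%:E)%E.
  by exists PX, PY; split => //; exact: in_class_atomic.
pose G (c : I -> R) v (xs : n.-tuple X) (bs : n.-tuple bool) :=
  \sum_i c i * (phi (xs, bs, pt i) == v)%:R.
have leG (c : I -> R) (P : probability X R) v :
    (forall A, P A = (\sum_i c i * \1_A (pt i))%:E) -> (forall i, 0 <= c i) ->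
    ((atomic_sample_sum pt q (G c v))%:E <= prob_pred PX PY w phi P v)%E.
  move=> PE c0; rewrite /prob_pred /q.
  apply: (le_atomic_sample_sum_int _ a b) => //.
    by move=> xs bs; apply: sumr_ge0 => i _; rewrite mulr_ge0.
  move=> xs bs; rewrite PE lee_fin; apply: ler_sum => i _.
  rewrite ler_wpM2l // indicE ler_nat; case: eqP => // phiE.
  by rewrite mem_set.
have GE xs bs : G a true xs bs + G b false xs bs =
    (1 - T) + \sum_i 2 * mu i * amp i * (phi (xs, bs, pt i) != t i)%:R.
  have -> : 1 - T = \sum_i (mu i * 2^-1 - mu i * amp i).
    by rewrite sumrB -mulr_suml mu2 mulfV ?pnatr_eq0.
  rewrite -!big_split /=.
  apply: eq_bigr => i _; rewrite eqb_id eqbF_neg /a /b /s.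
  by case: (t i); case: (phi _); rewrite /= ?expr0 ?expr1; field.
have q1 : \sum_z q z = 1.
  rewrite -(pair_bigA _ (fun v i => q (v, i))) big_bool /= -!mulr_sumr a1 b1.
  by rewrite !mulr1 addrC subrK.
have le2 := leeD (leG a PX true PXE a0) (leG b PY false PYE b0).
have leTV' : (T%:E <= (TV PX PY)%:E)%E by rewrite lee_fin.
apply: le_trans (leeD (leeD le2 (le_refl (-1)%E)) leTV').
rewrite -!EFinD lee_fin -atomic_sample_sumD.
have -> : (fun xs bs => G a true xs bs + G b false xs bs) =
    (fun xs bs => (1 - T) + \sum_i 2 * mu i * amp i * (phi (xs, bs, pt i) != t i)%:R).
  by apply/funext => xs; apply/funext => bs; exact: GE.
rewrite atomic_sample_sumD atomic_sample_sum_cst q1 expr1n mul1r.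
rewrite atomic_sample_sum_sum mulr_sumr.
under [in leRHS]eq_bigr do rewrite atomic_sample_sumZ.
under [in leLHS]eq_bigr do rewrite !mulrA.
lra.
Qed.

End excess_risk_atomic.

(** * Averaging over the signs of the pairs *)

Lemma bernoulli_ineq {R : realDomainType} (x : R) (n : nat) :
  0 <= x <= 1 -> 1 - n%:R * x <= (1 - x) ^+ n.
Proof.
move=> x01; elim: n => [|n IHn]; first by rewrite mul0r subr0 expr0.
have x'0 : 0 <= 1 - x by lra.
rewrite exprS; apply: le_trans (ler_wpM2l x'0 IHn).
have : 0 <= n%:R * x ^+ 2 by rewrite mulr_ge0 // sqr_ge0.
by rewrite -natr1; nra.
Qed.

(** As [f j] permutes [E], the mean of [D e j] over [e] is the mean of half of
    [D e j + D (f j e) j], so at least [c / 2]. Some [e] reaches the mean of the total. *)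
Lemma exists_ge_average_involution {R : realFieldType} {E J : finType}
    (f : J -> E -> E) (D : E -> J -> R) (c : R) :
  (0 < #|E|)%N -> (forall j, involutive (f j)) ->
  (forall e j, c <= D e j + D (f j e) j) ->
  exists e, \sum_(j : J) c / 2 <= \sum_j D e j.
Proof.
move=> E0 fK cD; apply: contrapT => noe.
have ltD e : \sum_j D e j < \sum_(j : J) c / 2.
  by rewrite ltNge; apply/negP => De; apply: noe; exists e.
have : \sum_e \sum_j D e j < \sum_(e : E) \sum_(j : J) c / 2.
  apply: ltr_sum => [|e _ //].
  by case/card_gt0P: E0 => e _; apply/hasP; exists e; rewrite ?mem_index_enum.
apply/negP; rewrite -leNgt [leLHS]exchange_big [leRHS]exchange_big.
apply: ler_sum => j _.
have -> : \sum_e D e j = \sum_e (D e j + D (f j e) j) / 2.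
  rewrite -mulr_suml big_split /=.
  have <- : \sum_e D e j = \sum_e D (f j e) j.
    by rewrite [LHS](reindex_inj (inv_inj (fK j))).
  by set S := (\sum_e _); field.
by apply: ler_sum => e _; rewrite ler_pM2r ?invr_gt0 ?ltr0n.
Qed.

Section hypercube.
Context {R : realType} {d : measure_display} {X : measurableType d}.
Variables (rho : X -> X -> R) (Y : set X) (C beta kappa w eta delta : R).
Variable m : nat.
(* Two atoms carrying half of the mass secure TV >= kappa; the other half is
   spread over m pairs of atoms, and the unknown sign eps j says which atom of
   the j-th pair is favoured by P_X.  Pairing keeps the masses of the pairs, and
   hence the probability that a sample avoids a pair, independent of eps. *)
Let I := (bool + 'I_m * bool)%type.
Variable pt : I -> X.
Let mass (i : I) : R := if i is inl _ then 2^-1 else (2 * m%:R)^-1.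
Let amp (i : I) : R := if i is inl _ then eta else delta.
Let label (eps : {ffun 'I_m -> bool}) (i : I) : bool :=
  match i with inl v => v | inr (j, v) => v (+) eps j end.
Let flip (j : 'I_m) (eps : {ffun 'I_m -> bool}) : {ffun 'I_m -> bool} :=
  [ffun k => eps k (+) (k == j)].
Let s eps i := (-1) ^+ label eps i * amp i.
Let q eps (z : bool * I) : R :=
  if z.1 then w * (mass z.2 * (2^-1 - s eps z.2))
  else (1 - w) * (mass z.2 * (2^-1 + s eps z.2)).
Hypotheses (measurable_pt : forall i, measurable [set pt i])
  (pt_inj : injective pt) (YI : forall i, Y (pt i)).
Hypotheses (w01 : 0 <= w <= 1) (m0 : (0 < m)%N) (C0 : 0 <= C).
Hypotheses (delta0 : 0 <= delta <= 2^-1) (eta2 : 0 <= eta <= 2^-1).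
Hypothesis kappa_eta : kappa <= eta.
Hypothesis amp_holder : forall i j, i != j ->
  amp i + amp j <= C * rho (pt i) (pt j) `^ beta.

Let mR0 : 0 < m%:R :> R. Proof. by rewrite ltr0n. Qed.

Let mass_ge0 i : 0 <= mass i.
Proof. by case: i => [v|jv]; rewrite /mass ?invr_ge0 ?mulr_ge0 ?ler0n. Qed.

Let amp01 i : 0 <= amp i <= 2^-1. Proof. by case: i. Qed.

Let sumI (F : I -> R) :
  \sum_i F i = F (inl true) + F (inl false) +
    \sum_j (F (inr (j, true)) + F (inr (j, false))).
Proof.
rewrite big_sumType big_bool; congr (_ + _).
transitivity (\sum_p F (inr (p.1, p.2))); first by apply: eq_bigr => -[].
rewrite -(pair_bigA _ (fun j v => F (inr (j, v)))).
by apply: eq_bigr => j _; rewrite big_bool.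
Qed.

Let s_pair eps j : s eps (inr (j, true)) + s eps (inr (j, false)) = 0.
Proof. by rewrite /s /=; case: (eps j); rewrite /= ?expr0 ?expr1; ring. Qed.

Let q_ge0 eps z : 0 <= q eps z.
Proof.
have s2 : - 2^-1 <= s eps z.2 <= 2^-1.
  by have := amp01 z.2; rewrite /s; case: (label _ _); rewrite /= ?expr0 ?expr1; lra.
rewrite /q; case: ifP => _; rewrite mulr_ge0 ?mulr_ge0 ?mass_ge0 //;
  have := w01; lra.
Qed.

(** Le Cam's two-point argument: on samples avoiding pair [j] the weights for [eps] and its flip
    coincide, while the labels at the atom are opposite, so exactly one error occurs. Such samples
    have mass at least (1 - 1/(2m))^n >= 1 - n/(2m) >= 1/2. *)
Lemma wrong_flip n (phi : @classifier d X n) eps (jv : 'I_m * bool) :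
  (n <= m)%N ->
  2^-1 <= atomic_sample_sum pt (q eps)
      (fun xs bs => (phi (xs, bs, pt (inr jv)) != label eps (inr jv))%:R)
    + atomic_sample_sum pt (q (flip jv.1 eps))
      (fun xs bs =>
         (phi (xs, bs, pt (inr jv)) != label (flip jv.1 eps) (inr jv))%:R).
Proof.
case: jv => j v /= nm.
pose avoid (i : I) := if i is inr (k, _) then k != j else true.
pose q0 z := if avoid z.2 then q eps z else 0.
have q0q z : 0 <= q0 z <= q eps z.
  by rewrite /q0; case: ifP => _; rewrite ?lexx q_ge0.
have q0flip z : 0 <= q0 z <= q (flip j eps) z.
  rewrite /q0; case: ifP; rewrite ?lexx ?q_ge0 //.
  case: z => u [v'|[k v']]; rewrite /q /s /label /flip /= ?ffunE ?lexx ?q_ge0 //.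
  by move=> /negbTE ->; rewrite addbF.
have sum_q0 : 1 - (2 * m%:R)^-1 <= \sum_z q0 z.
  have -> : \sum_z q0 z = \sum_i q0 (true, i) + \sum_i q0 (false, i).
    transitivity (\sum_z q0 (z.1, z.2)); first by apply: eq_bigr => -[].
    by rewrite -(pair_bigA _ (fun u i => q0 (u, i))) big_bool.
  rewrite !sumI.
  (* The opposite amplitudes within a pair cancel, so its total weight under either label is free of
     [eps]. *)
  pose g k : R := if k != j then (2 * m%:R)^-1 else 0.
  have q0pair k : (q0 (true, inr (k, true)) + q0 (true, inr (k, false)) = w * g k)
    * (q0 (false, inr (k, true)) + q0 (false, inr (k, false)) = (1 - w) * g k).
    rewrite /q0 /q /g /=; case: ifP => _; last by rewrite !addr0 !mulr0.
    by have := s_pair eps k; split; nra.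
  under eq_bigr do rewrite q0pair.
  under [X in _ + (_ + X)]eq_bigr do rewrite q0pair.
  rewrite -!mulr_sumr.
  have -> : \sum_k g k = 2^-1 - (2 * m%:R)^-1.
    rewrite -[2^-1](_ : \sum_(k < m) (2 * m%:R)^-1 = _); last first.
      rewrite sumr_const card_ord -mulr_natr; field.
      by rewrite gt_eqF.
    rewrite (bigD1 j) //= [in RHS](bigD1 j) //= /g eqxx add0r addrC addrK.
    by apply: eq_bigr => k ->.
  by rewrite /q0 /q /s /mass /= expr0 expr1; lra.
have wrong_ge0 eps' xs bs :
  0 <= (phi (xs, bs, pt (inr (j, v))) != label eps' (inr (j, v)))%:R :> R by [].
apply: le_trans (lerD
  (le_atomic_sample_sum pt _ _ _ _ q0q (wrong_ge0 eps))
  (le_atomic_sample_sum pt _ _ _ _ q0flip (wrong_ge0 (flip j eps)))).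
rewrite -atomic_sample_sumD.
have -> : (fun (xs : n.-tuple X) (bs : n.-tuple bool) =>
    (phi (xs, bs, pt (inr (j, v))) != label eps (inr (j, v)))%:R
    + (phi (xs, bs, pt (inr (j, v))) != label (flip j eps) (inr (j, v)))%:R)
    = (fun _ _ => 1 : R).
  apply/funext => xs; apply/funext => bs; rewrite /flip /= ffunE eqxx.
  by case: (phi _); case: (v); case: (eps j); rewrite /= ?addr0 ?add0r.
rewrite atomic_sample_sum_cst mulr1.
have m2 : 0 <= (2 * m%:R : R)^-1 <= 1.
  rewrite invr_ge0 mulr_ge0 //= invf_le1 ?mulr_gt0 //.
  by rewrite -natrM ler1n muln_gt0.
apply: le_trans (_ : (1 - (2 * m%:R)^-1) ^+ n <= _); last first.
  by rewrite lerXn2r // nnegrE; lra.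
apply: le_trans (bernoulli_ineq _ _ m2).
have : n%:R * (2 * m%:R)^-1 <= m%:R * (2 * m%:R)^-1 :> R.
  by rewrite ler_wpM2r ?ler_nat //; case/andP: m2.
have -> : m%:R * (2 * m%:R)^-1 = 2^-1 :> R by field; rewrite gt_eqF.
lra.
Qed.

(** Averaging [wrong_flip] over the 2m near atoms yields an [eps] with error sum at least m/2. Each
    near atom contributes with factor 2 * delta / (2m), and the far atoms contribute a nonnegative
    amount. *)
Lemma hypercube_excess_risk_ge n (phi : @classifier d X n) :
  (n <= m)%N ->
  ((delta / 2)%:E <= excess_risk rho Y C beta kappa w phi)%E.
Proof.
move=> nm.
have flipK j : involutive (flip j).
  by move=> eps; apply/ffunP => k; rewrite !ffunE addbK.
have card_eps : (0 < #|{: {ffun 'I_m -> bool}}|)%N.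
  by apply/card_gt0P; exists [ffun=> true].
have [eps] := exists_ge_average_involution
  (fun jv : 'I_m * bool => flip jv.1) _ _ card_eps
  (fun jv => flipK jv.1) (fun eps jv => wrong_flip n phi eps jv nm).
rewrite sumr_const card_prod card_ord card_bool.
pose S (i : I) : R := atomic_sample_sum pt (q eps)
  (fun xs bs => (phi (xs, bs, pt i) != label eps i)%:R).
rewrite -/(S _) => le_wrong.
have {}le_wrong : m%:R / 2 <= \sum_jv S (inr jv).
  apply: le_trans le_wrong; rewrite -[leRHS]mulr_natr natrM; lra.

have sum_mass : \sum_i mass i = 2.
  rewrite sumI /mass sumr_const card_ord -mulr_natr; field.
  by rewrite gt_eqF.
have sum_mass_s : \sum_i mass i * s eps i = 0.
  rewrite sumI big1 => [|j _]; last by rewrite /mass -mulrDr s_pair mulr0.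
  by rewrite /mass /s /= expr0 expr1; ring.
have s_holder i j : `|s eps i - s eps j| <= C * rho (pt i) (pt j) `^ beta.
  have [->|ij] := eqVneq i j.
    by rewrite subrr normr0 mulr_ge0 // powR_ge0.
  apply: le_trans (amp_holder _ _ ij).
  have := amp01 i; have := amp01 j; rewrite /s ler_norml.
  by case: (label _ _); case: (label _ _); rewrite /= ?expr0 ?expr1; lra.
have kappaT : kappa <= \sum_i mass i * amp i.
  apply: le_trans kappa_eta _; rewrite sumI /mass /amp.
  have : 0 <= \sum_(j < m) ((2 * m%:R)^-1 * delta + (2 * m%:R)^-1 * delta).
    apply: sumr_ge0 => j _; case/andP: delta0 => d0 _.
    by rewrite addr_ge0 // mulr_ge0 // invr_ge0 mulr_ge0.
  lra.
apply: le_trans (excess_risk_ge measurable_pt pt_inj rho Y C beta kappa w mass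
  amp (label eps) w01 YI mass_ge0 amp01 sum_mass sum_mass_s kappaT s_holder n phi).
rewrite lee_fin.
apply: le_trans (_ : 2 * (\sum_v mass (inl v) * amp (inl v) * S (inl v)
  + \sum_jv (2 * m%:R)^-1 * delta * S (inr jv)) <= _); last by rewrite big_sumType.
have S0 i : 0 <= S i.
  by apply: atomic_sample_sum_ge0 => [z|xs bs]; rewrite ?q_ge0.
have far0 : 0 <= \sum_(v : bool) mass (inl v) * amp (inl v) * S (inl v).
  by apply: sumr_ge0 => v _; rewrite !mulr_ge0 //; case/andP: (amp01 (inl v)).
rewrite -mulr_sumr mulrDr; apply: ler_wpDl; first by rewrite mulr_ge0.
have -> : delta / 2 = 2 * ((2 * m%:R)^-1 * delta * (m%:R / 2)).
  by field; rewrite gt_eqF.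
have [d0 _] := andP delta0.
by rewrite ler_wpM2l // ler_wpM2l // mulr_ge0 // invr_ge0 mulr_ge0.
Qed.

End hypercube.

(** * Coverings and separated points *)

Section covering_packing.
Context {R : realType} {X : Type}.
Implicit Types (rho : X -> X -> R) (Y : set X) (r : R).

Lemma covers_with_card (I : finType) rho r Y (c : I -> X) :
  Y `<=` \bigcup_i rho_ball rho (c i) r -> covers_with rho r Y #|I|.
Proof.
move=> Yc; exists (fun i => c (enum_val i)) => y /Yc[i _ yi].
by exists (enum_rank i) => //; rewrite enum_rankK.
Qed.

Lemma covers_with_leq (x0 : X) rho r Y k l :
  (k <= l)%N -> covers_with rho r Y k -> covers_with rho r Y l.
Proof.
move=> kl [c Yc].
(* The surplus balls are centred at [x0]. *)
exists (fun i : 'I_l => if insub (i : nat) is Some j then c j else x0).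
move=> y /Yc[i _ yi]; exists (widen_ord kl i) => //=.
by rewrite (_ : insub (i : nat) = Some i) //; exact: valK.
Qed.

(** Greedy choice: fewer than [#|I|] balls around the points chosen so far cannot cover [Y], so a
    further point lies outside all of them. *)
Lemma exists_separated (I : finType) (x0 : X) rho r Y :
  (forall x y, rho x y = rho y x) ->
  (forall k, (k < #|I|)%N -> ~ covers_with rho r Y k) ->
  exists x : I -> X, (forall i, Y (x i)) /\
    forall i j, i != j -> r <= rho (x i) (x j).
Proof.
move=> rhoC nocov.
suff /(_ _ (leqnn #|I|))[x [Yx sep]] : forall k, (k <= #|I|)%N ->
    exists x : nat -> X, (forall i, (i < k)%N -> Y (x i)) /\
      forall i j, (i < j < k)%N -> r <= rho (x i) (x j).
  exists (fun i => x (enum_rank i)); split=> [i|i j]; first exact: Yx.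
  rewrite -(inj_eq (@enum_rank_inj I)) neq_ltn.
  by case/orP => ij; [|rewrite rhoC]; apply: sep; apply/andP; split.
elim=> [_|k IHk kI].
  by exists (fun=> x0); split=> // i j; rewrite ltn0 andbF.
have [x [Yx sep]] := IHk (ltnW kI).
have [y [Yy far]] : exists y, Y y /\ forall i, (i < k)%N -> r <= rho (x i) y.
  apply: contrapT => noy; apply: (nocov k kI); exists (fun i => x i) => y Yy.
  apply: contrapT => nocy; apply: noy; exists y; split=> // i ik.
  by rewrite leNgt; apply/negP => yi; apply: nocy; exists (Ordinal ik).
exists (fun i => if (i < k)%N then x i else y); split=> [i _|i j].
  by case: ifP => [/Yx|].
rewrite ltnS => /andP[ij jk]; rewrite (leq_trans ij jk).
by case: ifP => [jk'|_]; [exact: (sep _ _ (introT andP (conj ij jk')))|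
  exact: far (leq_trans ij jk)].
Qed.

(** If every piece had a cover by fewer than [M] balls, padding each to [M] balls and joining them
    would cover [Y] by [K * M] balls. *)
Lemma covering_pigeonhole (K : nat) (x0 : X) (c : 'I_K -> X) rho r s Y M :
  Y `<=` \bigcup_i rho_ball rho (c i) r ->
  ~ covers_with rho s Y (K * M) ->
  exists i, forall k, (k < M)%N ->
    ~ covers_with rho s (Y `&` rho_ball rho (c i) r) k.
Proof.
move=> Yc nocov; apply: contrapT => noi; apply: nocov.
have cov i : covers_with rho s (Y `&` rho_ball rho (c i) r) M.
  apply: contrapT => nocov; apply: noi; exists i => k kM covk.
  by apply: nocov; exact: covers_with_leq x0 _ _ _ _ _ (ltnW kM) covk.
have [e eP] := choice cov.
have := @covers_with_card ('I_K * 'I_M)%type rho s Y (fun p => e p.1 p.2).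
rewrite card_prod !card_ord; apply => y Yy; have [i _ yi] := Yc y Yy.
by have [|j _ yj] := eP i y; [split|exists (i, j)].
Qed.

(** By the triangle inequality the open ball of radius 2r around [c] holds at most one of the three
    points. *)
Lemma exists_two_far (rho : X -> X -> R) r (y : 'I_3 -> X) (c : X) :
  is_metric rho -> (forall i j, i != j -> 4 * r <= rho (y i) (y j)) ->
  exists i j, [/\ i != j, 2 * r <= rho c (y i) & 2 * r <= rho c (y j)].
Proof.
move=> [_ _ rhoC tri] sep.
have close i j : i != j -> rho c (y i) < 2 * r -> 2 * r <= rho c (y j).
  move=> ij ci; have := sep i j ij; have := tri (y i) c (y j).
  by rewrite (rhoC (y i) c); lra.
pose o1 : 'I_3 := @Ordinal 3 1 isT; pose o2 : 'I_3 := @Ordinal 3 2 isT.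
have [c0|c0] := leP (2 * r) (rho c (y ord0)); last first.
  by exists o1, o2; split=> //; apply: close c0.
have [c1|c1] := leP (2 * r) (rho c (y o1)); first by exists ord0, o1.
by exists ord0, o2; split=> //; apply: close c1.
Qed.

Lemma covering_number_le rho r Y k :
  covers_with rho r Y k -> (covering_number rho r Y <= k%:R%:E)%E.
Proof. by move=> cov; apply: ereal_inf_lbound; exists k. Qed.

Lemma covering_number_fin rho r Y :
  covering_number rho r Y \is a fin_num -> exists k, covers_with rho r Y k.
Proof.
move=> fin; apply: contrapT => nocov; move: fin.
rewrite /covering_number (_ : [set _ | _ in _] = set0) ?ereal_inf0 //.
by rewrite -subset0 => t [k cov _]; apply: nocov; exists k.
Qed.

End covering_packing.

(** * Singletons, real powers and lower limits *)

Lemma measurable_set1_of_open {R : realType} {d : measure_display}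
    {X : measurableType d} (rho : X -> X -> R) (x : X) :
  is_metric rho -> @measurable d X = <<s rho_open rho >> ->
  measurable [set x].
Proof.
move=> [rho0 rhoE _ _] mE; rewrite -(setCK [set x]); apply: measurableC.
rewrite mE; apply: sub_sigma_algebra => y /= yx.
exists (rho y x); last by move=> z /= + zx; rewrite /rho_ball /= zx ltxx.
by rewrite lt_neqAle rho0 andbT eq_sym; apply/eqP => /rhoE.
Qed.

Lemma powRNV {R : realType} (g L : R) :
  0 < g -> 0 <= L -> (L `^ (- g^-1)) `^ (- g) = L.
Proof.
by move=> g0 L0; rewrite -powRrM mulrNN mulVf ?gt_eqF // powRr1.
Qed.

Lemma ler_powRN {R : realType} (g x y : R) :
  0 <= g -> 0 < x -> x <= y -> y `^ (- g) <= x `^ (- g).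
Proof.
move=> g0 x0 xy; have y0 := lt_le_trans x0 xy.
rewrite !powRN lef_pV2 ?posrE ?powR_gt0 //.
by apply: ge0_ler_powR => //; rewrite nnegrE ltW.
Qed.

Lemma limn_einf_gt0 {R : realType} (u : (\bar R)^nat) (L : R) (N : nat) :
  0 < L -> (forall n, (N <= n)%N -> (L%:E <= u n)%E) -> (0 < limn_einf u)%E.
Proof.
move=> L0 Lu; apply: lt_le_trans (_ : (L%:E <= _)%E); first by rewrite lte_fin.
rewrite limn_einf_lim (cvg_lim _ (@cvg_einfs_sup _ u)) //.
apply: le_ereal_sup_tmp; exists (einfs u N); first by exists N.
by apply: le_ereal_inf_tmp => _ [n /= Nn <-]; exact: Lu.
Qed.

(** * Choice of the scales and of the atoms *)

Theorem theorem4 (R : realType) (d : measure_display) (X : measurableType d)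
    (rho : X -> X -> R) (Y : set X) (s0 c0 c1 gamma C beta w : R) :
  polish_metric rho ->
  [set: X] !=set0 ->
  @measurable d X = <<s rho_open rho >> ->
  measurable Y ->
  0 < s0 -> 0 < c0 -> c0 < c1 -> 0 < gamma ->
  (forall s, 0 < s < s0 ->
     covering_number rho s Y \is a fin_num /\
     c0 * s `^ (- gamma) <= ln (fine (covering_number rho s Y)) <= c1 * s `^ (- gamma)) ->
  0 < C -> 0 < beta <= 1 -> 0 < w < 1 ->
  exists kappa0 : R, 0 < kappa0 /\
    forall kappa : R, 0 < kappa < kappa0 ->
    forall phi : forall n : nat, @classifier d X n,
      (forall n, measurable_fun setT (phi n)) ->
      (0 < limn_einf (fun n : nat =>
         ((ln n%:R) `^ (beta / gamma))%:E * excess_risk rho Y C beta kappa w (phi n)))%E.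
Proof.
move=> [rho_metric _ _] [x0 _] mE _ s00 c00 _ g0 cov C0 /andP[b0 _] /andP[w0 w1].
have [rho0 rhoE rhoC tri] := rho_metric.
have expR_le_cov s k : 0 < s < s0 -> covers_with rho s Y k ->
    expR (c0 * s `^ (- gamma)) <= k%:R.
  move=> ss; have [Nfin /andP[lnN _]] := cov s ss.
  have s_gt0 : 0 < s by case/andP: ss.
  move=> /covering_number_le; rewrite -(fineK Nfin) lee_fin; apply: le_trans.
  have lnN0 := lt_le_trans (mulr_gt0 c00 (powR_gt0 (- gamma) s_gt0)) lnN.
  (* [ln] is 0 at nonpositive arguments, so a positive logarithm forces a positive argument. *)
  have N0 : 0 < fine (covering_number rho s Y).
    by rewrite ltNge; apply/negP => /ln0 lnE; rewrite lnE ltxx in lnN0.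
  by rewrite -[leRHS](lnK N0) ler_expR.
have c02 : 0 < 2 / c0 by rewrite divr_gt0.
(* [u0] solves c0 u^(-gamma) = 2. Below it a cover needs at least exp 2 >= 3 balls, which gives
   three separated points. *)
pose u0 := (2 / c0) `^ (- gamma^-1).
have u00 : 0 < u0 by rewrite powR_gt0.
pose s1 := Order.min (s0 / 2) u0.
have s10 : 0 < s1 by rewrite lt_min divr_gt0.
have s1s0 : s1 < s0.
  by apply: (@le_lt_trans _ _ (s0 / 2)); [rewrite ge_min lexx|lra].
have [y [Yy ysep]] : exists y : 'I_3 -> X, (forall i, Y (y i)) /\
    forall i j, i != j -> s1 <= rho (y i) (y j).
  apply: exists_separated => // k; rewrite card_ord => k3 covk.
  have := expR_le_cov s1 k; rewrite s10 s1s0 => /(_ isT covk).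
  apply/negP; rewrite -ltNge; apply: lt_le_trans (_ : 1 + 2 <= _).
    by have : k%:R < 3%:R :> R; [rewrite ltr_nat|lra].
  apply: le_trans (expR_ge1Dx _) _; rewrite ler_expR -ler_pdivrMl //.
  rewrite mulrC -(powRNV _ _ g0 (ltW c02)).
  by apply: ler_powRN (ltW g0) s10 _; rewrite ge_min lexx orbT.
(* Points 4r apart leave two at distance 2r from any centre, hence at distance r from the ball of
   radius r around it. *)
pose r := s1 / 4.
have r0 : 0 < r by rewrite divr_gt0.
have rs0 : 0 < r < s0 by rewrite r0 /r; lra.
have [K [c Yc]] := covering_number_fin _ _ _ (cov r rs0).1.
(* The second bound is the Hölder condition at distance [r]; the first keeps amplitudes below
   1/2. *)
pose eta := Order.min (4^-1) (C * r `^ beta / 2).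
have rb0 : 0 < C * r `^ beta by rewrite mulr_gt0 // powR_gt0.
have eta0 : 0 < eta by rewrite lt_min invr_gt0 ltr0n divr_gt0.
have eta_r : eta + eta <= C * r `^ beta.
  have : eta <= C * r `^ beta / 2 by rewrite ge_min lexx orbT.
  lra.
have eta4 : eta <= 4^-1 by rewrite ge_min lexx.
exists eta; split=> // kappa /andP[_ /ltW kappa_eta] phi _.
(* A scale [s <= tau] lies below [s0] and gives [delta <= eta]. *)
pose tau := Order.min (s0 / 2) ((2 * eta / C) `^ beta^-1).
have etaC : 0 < 2 * eta / C by rewrite divr_gt0 ?mulr_gt0.
have tau0 : 0 < tau by rewrite lt_min divr_gt0 //= powR_gt0.
have tau_s0 : tau < s0.
  by apply: (@le_lt_trans _ _ (s0 / 2)); [rewrite ge_min lexx|lra].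
have tau_beta : tau `^ beta <= 2 * eta / C.
  have -> : 2 * eta / C = ((2 * eta / C) `^ beta^-1) `^ beta.
    by rewrite -powRrM mulVf ?gt_eqF // powRr1 // ltW.
  apply: ge0_ler_powR; rewrite ?nnegrE ?powR_ge0 ?(ltW b0) ?(ltW tau0) //.
  by rewrite ge_min lexx orbT.
(* [lmin <= ln n] amounts to [s <= tau] for the scale [s] chosen below. *)
pose lmin := c0 * tau `^ (- gamma) / 2.
have lmin0 : 0 < lmin by rewrite divr_gt0 // mulr_gt0 // powR_gt0.
(* The constant is the exact value of (log n)^(beta/gamma) * delta/2. The threshold ensures 2K < n
   and [lmin <= ln n]. *)
apply: (limn_einf_gt0 _ (C / 4 * (2 / c0) `^ (- (beta / gamma)))
  (maxn (2 * K).+1 (Num.bound (expR lmin)))).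
  by rewrite mulr_gt0 ?divr_gt0 // powR_gt0 // divr_gt0.
move=> n; rewrite geq_max => /andP[Kn bn].
have n0 : (0 < n)%N by apply: leq_ltn_trans Kn.
have nR0 : 0 < n%:R :> R by rewrite ltr0n.
have lmin_le : lmin <= ln n%:R.
  rewrite -ler_expR lnK // ltW //.
  apply: lt_le_trans (archi_boundP (expR_ge0 _)) _; by rewrite ler_nat.
have ln0 : 0 < ln (n%:R : R) by apply: lt_le_trans lmin_le.
pose s := (2 / c0 * ln n%:R) `^ (- gamma^-1).
have s_gt0 : 0 < s by rewrite powR_gt0 // mulr_gt0.
have s_le : s <= tau.
  have -> : tau = (tau `^ (- gamma)) `^ (- gamma^-1).
    by rewrite -powRrM mulrNN mulfV ?gt_eqF // powRr1 // ltW.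
  apply: ler_powRN; rewrite ?invr_ge0 ?(ltW g0) ?powR_gt0 //.
  by rewrite mulrAC ler_pdivlMr //; move: lmin_le; rewrite /lmin; lra.
pose delta := C * s `^ beta / 2.
have delta0 : 0 <= delta by rewrite divr_ge0 // mulr_ge0 ?powR_ge0 ?(ltW C0).
have delta_eta : delta <= eta.
  have : s `^ beta <= 2 * eta / C.
    apply: le_trans tau_beta; apply: ge0_ler_powR;
      rewrite ?nnegrE ?(ltW b0) ?(ltW tau0) ?(ltW s_gt0) //.
  by rewrite ler_pdivlMr // /delta; lra.
have sE : c0 * s `^ (- gamma) = ln n%:R + ln n%:R.
  rewrite /s (powRNV _ _ g0 (ltW (mulr_gt0 c02 ln0))); field.
  by rewrite gt_eqF.
(* A cover at scale [s] needs exp(2 log n) = n^2 > 2Kn balls. *)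
have nocov : ~ covers_with rho s Y (K * #|{: 'I_n * bool}|).
  move=> /expR_le_cov; rewrite s_gt0 (le_lt_trans s_le tau_s0) => /(_ isT).
  rewrite sE expRD lnK // -natrM ler_nat card_prod card_ord card_bool.
  by rewrite mulnCA leq_pmul2l // leqNgt mulnC Kn.
have [i nocov_i] := covering_pigeonhole _ x0 _ _ _ _ _ _ Yc nocov.
have [x [Yx xsep]] := exists_separated _ x0 _ _ _ rhoC nocov_i.
have [j1 [j2 [j12 far1 far2]]] : exists j1 j2, [/\ j1 != j2,
    2 * r <= rho (c i) (y j1) & 2 * r <= rho (c i) (y j2)].
  apply: exists_two_far => // j1 j2 /ysep; rewrite /r; lra.
pose pt (z : bool + 'I_n * bool) : X :=
  match z with inl v => y (if v then j1 else j2) | inr jv => x jv end.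
have far_near v jv : r <= rho (pt (inl v)) (pt (inr jv)).
  have [_ near] := Yx jv; have := tri (c i) (x jv) (pt (inl v)).
  move: near; rewrite /rho_ball /= (rhoC (x jv)).
  by case: v => /=; lra.
have far_far v v' : v != v' -> r <= rho (pt (inl v)) (pt (inl v')).
  move=> vv'; apply: le_trans (_ : s1 <= _); first by rewrite /r; lra.
  by case: v v' vv' => [] [] //= _; apply: ysep => //; rewrite eq_sym.
have C_mono u v : 0 < u -> u <= v -> C * u `^ beta <= C * v `^ beta.
  move=> u0' uv; rewrite ler_pM2l //; apply: ge0_ler_powR;
    rewrite ?nnegrE ?(ltW b0) ?(ltW u0') //.
  exact: le_trans (ltW u0') uv.
have pt_dist z z' : z != z' -> 0 < rho (pt z) (pt z').
  case: z z' => [v|jv] [v'|jv'] zz'.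
  - by apply: lt_le_trans (far_far _ _ _).
  - exact: lt_le_trans (far_near _ _).
  - by rewrite rhoC; apply: lt_le_trans (far_near _ _).
  - by apply: lt_le_trans (xsep _ _ _).
have pt_inj : injective pt.
  move=> z z' zz'; apply/eqP; apply: contraT => /pt_dist.
  by rewrite zz' (rhoE _ _).2 // ltxx.
have mpt z : measurable [set pt z] by exact: measurable_set1_of_open rho_metric mE.
have Ypt z : Y (pt z) by case: z => [v|jv]; [exact: Yy|case: (Yx jv)].
(* Two near atoms use 2 delta = C s^beta; every other pair is r-separated and uses delta <= eta with
   2 eta <= C r^beta. *)
have holder z z' : z != z' ->
    (if z is inl _ then eta else delta) + (if z' is inl _ then eta else delta)
    <= C * rho (pt z) (pt z') `^ beta.
  case: z z' => [v|jv] [v'|jv'] zz'.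
  - by apply: le_trans eta_r _; apply: C_mono => //; apply: far_far.
  - apply: le_trans (C_mono _ _ r0 (far_near _ _)); lra.
  - rewrite rhoC; apply: le_trans (C_mono _ _ r0 (far_near _ _)); lra.
  - apply: le_trans (C_mono _ _ s_gt0 (xsep _ _ zz')); rewrite /delta; lra.
have risk : ((delta / 2)%:E <= excess_risk rho Y C beta kappa w (phi n))%E.
  apply: hypercube_excess_risk_ge mpt pt_inj Ypt _ n0 (ltW C0) _ _
    kappa_eta holder _ _ (leqnn n).
  - by rewrite !ltW.
  - by rewrite delta0; lra.
  - by rewrite ltW //; lra.
apply: le_trans (lee_wpmul2l _ risk); last by rewrite lee_fin powR_ge0.
rewrite -EFinM lee_fin /delta /s -powRrM mulNr [_ * beta]mulrC.
rewrite (powRM _ (ltW c02) (ltW ln0)) (powRN (ln _)).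
have lb0 : ln (n%:R : R) `^ (beta / gamma) != 0 by rewrite gt_eqF // powR_gt0.
by rewrite le_eqVlt; apply/orP; left; apply/eqP; field.
Qed.
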